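(* Let $\mu$ be the unique invariant measure of the period-doubling subshift. Let $u$ be an allowed $m$-word ($m\ge 1$), let $k\ge 0$ be such that $2^k\le m<2^{k+1}$, put $q=m-2^k$, and let $i$ be the least positive integer such that $u=w_i^{(m)}$. Then $1\le i\le 3\cdot 2^k$, and (1) if $i\le 2^k-q$, or if $q<2^{k-1}$ and $2^k<i\le 2^k+2^{k-1}-q$, then $\mu([u])=\dfrac{2}{3\cdot 2^k}$; (2) otherwise $\mu([u])=\dfrac{1}{3\cdot 2^k}$.
   Context: The period-doubling sequence $\omega=\omega_1\omega_2\ldots=0100\,0101\,0100\,0100\ldots$ is the unique fixed point in $\{0,1\}^{\mathbb{N}}$ ($\mathbb{N}=\{1,2,\dots\}$) of the substitution $0\mapsto 01$, $1\mapsto 00$; equivalently, $\omega_i=k_i\bmod 2$, where $k_i$ is the largest integer such that $2^{k_i}$ divides $i$. For integers $m,i\ge 1$, $w_i^{(m)}=\omega_i\omega_{i+1}\ldots\omega_{i+m-1}$. An allowed $m$-word is a word of length $m$ occurring as a subword of $\omega$, i.e. one of the words $w_i^{(m)}$. The shift is $\sigma(\alpha_1\alpha_2\alpha_3\ldots)=\alpha_2\alpha_3\ldots$ on $\{0,1\}^{\mathbb{N}}$ (product topology). The period-doubling subshift is $(X,\sigma)$, where $X$ is the closure of $\{\sigma^n(\omega):n\ge 0\}$; it is strictly ergodic (minimal and uniquely ergodic), so it has a unique $\sigma$-invariant Borel probability measure $\mu$. For an $m$-word $u=u_1\ldots u_m$, the cylinder is $[u]=\{\alpha : \alpha_j=u_j\text{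 for } 1\le j\le m\}$, and $\mu([u])$ means $\mu([u]\cap X)$. *)

(* Defs.v *)
From HB Require Import structures.
From mathcomp Require Import all_boot all_order all_algebra.
From mathcomp Require Import zify.
From mathcomp Require Import all_classical all_reals all_analysis.

Set Implicit Arguments.
Unset Strict Implicit.
Unset Printing Implicit Defensive.

Import Order.TTheory GRing.Theory Num.Theory.

Local Open Scope classical_set_scope.

(* The letters 0 and 1 are [false] and [true].  A sequence
   alpha_1 alpha_2 ... is an element [a] of [cantor_space] (bool^nat with the
   product topology), the letter alpha_j being [a j.-1]. *)

Definition pd_letter (i : nat) : bool := odd (logn 2 i).

Definition pd_seq : cantor_space := fun n => pd_letter n.+1.

Definition pd_rule (b : bool) : 2.-tuple bool :=
  if b then [tuple false; false] else [tuple false; true].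

Definition pd_subst (a : cantor_space) : cantor_space :=
  fun n => nth false (pd_rule (a n./2)) (odd n).

Lemma pd_seq_unique_fixpoint (a : cantor_space) :
  pd_subst a = a <-> a = pd_seq.
Proof.
have fixE : forall b : cantor_space, pd_subst b = b ->
    forall n, b n = if odd n then ~~ b n./2 else false.
  move=> b bE n; rewrite -{1}bE /pd_subst /pd_rule.
  by case: (b n./2); case: (odd n).
have pdE : pd_subst pd_seq = pd_seq.
  apply/funext => n; rewrite /pd_subst /pd_seq /pd_letter /pd_rule.
  have -> : logn 2 n.+1 = if odd n then (logn 2 n./2.+1).+1 else 0.
    case: ifPn => on.
      have -> : n.+1 = (2 * n./2.+1)%N.
        by rewrite -[in LHS](odd_double_half n) on mul2n doubleS.
      by rewrite lognM // logn_prime // eqxx.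
    by rewrite lognE /= dvdn2 /= on.
  by case: (odd n) => /=; case: (odd (logn 2 n./2.+1)).
split=> [aE|->//]; apply/funext => n.
have [N] := ubnP n; elim: N n => // N IH n nN.
rewrite (fixE _ aE) (fixE _ pdE); case: ifP => // on; rewrite IH//.
by have := odd_double_half n; rewrite on; lia.
Qed.

Definition shift (a : cantor_space) : cantor_space := fun n => a n.+1.

Definition pd_space : set cantor_space :=
  closure (range (fun n => iter n shift pd_seq)).

Lemma shift_continuous : continuous shift.
Proof.
move=> a; apply/cvg_sup => n; apply/cvg_image.
  by rewrite eqEsubset; split=> // b _; exists (fun=> b).
move=> B /(@proj_continuous _ (fun=> bool) n.+1 a) aB.
exists (proj n @^-1` B) => //; apply: image_preimage.
by rewrite eqEsubset; split=> // b _; exists (fun=> b).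
Qed.

Lemma shift_pd_space (a : cantor_space) :
  a \in pd_space -> shift a \in pd_space.
Proof.
rewrite !inE => Xa B /shift_continuous /Xa[_ [[n _ <-] Bn]].
by exists (iter n.+1 shift pd_seq); split => //; exists n.+1.
Qed.

Lemma pd_seq_in : pd_seq \in pd_space.
Proof. by rewrite inE; apply: subset_closure; exists 0%N. Qed.

Definition pd_subshift : Type := set_type pd_space.

HB.instance Definition _ := Topological.on pd_subshift.
HB.instance Definition _ :=
  isPointed.Build pd_subshift (exist _ pd_seq pd_seq_in).

Definition pd_shift (x : pd_subshift) : pd_subshift :=
  exist _ (shift (set_val x)) (shift_pd_space (valP x)).

Definition borel (T : ptopologicalType) := g_sigma_algebraType (@open T).

Definition pd_invariant (R : realType)
    (mu : probability (borel pd_subshift) R) : Prop :=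
  forall A : set (borel pd_subshift), measurable A ->
    mu (pd_shift @^-1` A) = mu A.

Definition pd_word (m i : nat) : m.-tuple bool :=
  [tuple pd_letter (i + j) | j < m].

Definition allowed (m : nat) (u : m.-tuple bool) : Prop :=
  exists2 i, (1 <= i)%N & u = pd_word m i.

Definition cylinder (m : nat) (u : m.-tuple bool) : set cantor_space :=
  [set a | forall j : 'I_m, a j = tnth u j].

(* Main.v *)
Require Import Defs.
From HB Require Import structures.
From mathcomp Require Import all_boot all_order all_algebra.
From mathcomp Require Import zify lra.
From mathcomp Require Import all_classical all_reals all_analysis.
From mathcomp Require Import measurable_realfun.

(** Write N = 2^k, so that m = N + q with 0 <= q < N, and write a position i
    uniquely as i = N a - r with 0 <= r < N.  A letter of omega at a place that
    is not a multiple of N depends only on that place modulo N, and the letter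
    at N b is omega_b, complemented when k is odd.  The window of length m at i
    meets the multiple N a, meets N (a+1) exactly when r < q, and never meets
    N (a+2).  Hence w_i^(m) is determined by r and omega_a when r >= q, and by
    r and the pair omega_a omega_(a+1) when r < q ([pd_word_renorm]).

    These data are nearly determined by the word.  Equal words of length at
    least N start at positions that are congruent modulo N/2
    ([pd_word_recognizable]), since three letters of omega already reveal the
    parity of a position and the letters at even places desubstitute.  If they
    are not congruent modulo N, then all multiples of N/2 in the windows carry
    the same letters although the windows have opposite phases; this forces
    omega_a = 1 and q <= s < N/2, where s and s + N/2 are the two residues r
    ([pd_word_eq_half]).  Conversely, in that case the words do agree
    ([pd_word_half_eq]).  So, apart from these twins, distinct data give
    distinct words.

    In omega the letters 1 and 0 have density 1/3 and 2/3, and each of the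
    pairs 01, 10, 00 has density 1/3 (the pair 11 does not occur).  A word with
    r < q therefore has density 1/(3N); a word with r >= q has density 2/(3N) if
    omega_a = 0, density 1/(3N) if omega_a = 1 and it has no twin, and 2/(3N) if
    it has one.  As omega starts with 0100, the least position i has a <= 3 in
    the first case; in the other one it has a = 1 if omega_a = 0, and a = 2 if
    omega_a = 1, with the larger residue when there is a twin.  Reading off
    i = N a - r gives the two cases of the theorem.

    Density becomes measure as follows.  In a window of length 2^n of omega, the
    number of ones differs from 2^n/3 by a bounded amount
    ([frequency_pd_letter]), whatever the position of the window and n; so the
    number of occurrences of u in a window of length N 2^n differs from c 2^n/3
    by a bounded amount, with c = 1 or 2.  Every point of the subshift agrees
    with omega on long windows, so integrating the number of visits to [u] along
    N 2^n steps of the shift gives N 2^n mu([u]) up to a bounded error;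
    letting n grow yields mu([u]) = c/(3N) ([measure_cylinder_frequency]). *)

Set Implicit Arguments.
Unset Strict Implicit.
Unset Printing Implicit Defensive.

Import Order.TTheory GRing.Theory Num.Theory.

Local Open Scope classical_set_scope.

(** * The letters of the period-doubling sequence *)

Lemma pd_letter_odd n : odd n -> pd_letter n = false.
Proof. by move=> on; rewrite /pd_letter lognE /= dvdn2 on andbF. Qed.

Lemma pd_letter_pow2M k n : 0 < n ->
  pd_letter (2 ^ k * n) = odd k (+) pd_letter n.
Proof.
by move=> n0; rewrite /pd_letter lognM ?expn_gt0// pfactorK// oddD.
Qed.

Lemma pd_letter_double n : 0 < n -> pd_letter (2 * n) = ~~ pd_letter n.
Proof. exact: (@pd_letter_pow2M 1). Qed.

Lemma pd_letter_no11 n : pd_letter n -> pd_letter n.+1 = false.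
Proof.
case: (boolP (odd n)) => on; first by rewrite pd_letter_odd.
by rewrite (@pd_letter_odd n.+1).
Qed.

(** The 2-adic valuation of a number not divisible by 2^k is visible modulo
    2^k. *)
Lemma pd_letter_congr k n n' : n = n' %[mod 2 ^ k] -> ~~ (2 ^ k %| n) ->
  pd_letter n = pd_letter n'.
Proof.
elim: k n n' => [|k IH] n n' eq_nn' ndvd; first by rewrite dvd1n in ndvd.
have eq2 : n = n' %[mod 2].
  have d2 : 2 %| 2 ^ k.+1 by rewrite expnS dvdn_mulr.
  by rewrite -(modn_dvdm n d2) eq_nn' modn_dvdm.
have odd_eq : odd n = odd n' by rewrite !modn2 in eq2; case: odd eq2; case: odd.
case: (boolP (odd n)) => on; first by rewrite !pd_letter_odd -?odd_eq.
have [[b nE] [b' n'E]] : (exists b, n = 2 * b) /\ (exists b, n' = 2 * b).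
  by split; [exists n./2|exists n'./2]; rewrite mul2n even_halfK// -odd_eq.
move: eq_nn' ndvd; rewrite nE n'E expnS -!muln_modr dvdn_pmul2l// => /eqP.
rewrite eqn_pmul2l// => /eqP eq_bb' ndvd.
have b0 : 0 < b by case: b ndvd {nE eq_bb'} => //; rewrite dvdn0.
have b'0 : 0 < b'.
  case: b' eq_bb' {n'E} => // bb'; move: ndvd.
  by rewrite /dvdn bb' mod0n.
by rewrite !pd_letter_double// (IH b b').
Qed.

(** Every pair of consecutive letters already occurs at position 1, 2 or 3;
    this is what bounds the least position of a word. *)
Lemma pd_letter_pair_early a : exists b, [/\ 0 < b, b <= 3,
  pd_letter b = pd_letter a & pd_letter b.+1 = pd_letter a.+1].
Proof.
case La : (pd_letter a); last case La1 : (pd_letter a.+1).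
- by exists 2; rewrite (pd_letter_no11 La).
- by exists 1.
- by exists 3.
Qed.

(** * Positions relative to the multiples of a power of two *)

(** The coordinates r and a of a position i = 2^k a - r: the first multiple of
    2^k met by a window starting at i is the a-th one, at distance r.  The
    additive form avoids truncated subtraction. *)
Definition precedes k r a i := [/\ r < 2 ^ k, 0 < a & i + r = 2 ^ k * a].

Lemma ceil_decomp N i : 0 < N -> 0 < i ->
  exists r a, [/\ r < N, 0 < a & i + r = N * a].
Proof.
move=> N0 i0; have := divn_eq i.-1 N; have := ltn_pmod i.-1 N0.
move: (_ %/ _) (_ %% _) => a s sN iE.
by exists (N.-1 - s), a.+1; split; lia.
Qed.

Lemma precedes_gt0 k r a i : precedes k r a i -> 0 < i.
Proof.
move=> [rN a0 iE].
by have : 2 ^ k * 1 <= 2 ^ k * a; [rewrite leq_pmul2l ?expn_gt0|lia].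
Qed.

Lemma precedes_unique k r a s b i :
  precedes k r a i -> s < 2 ^ k -> i + s = 2 ^ k * b -> s = r /\ b = a.
Proof.
move=> [rN a0 iE] sN sE; have N0 : 0 < 2 ^ k by rewrite expn_gt0.
have : s == r %[mod 2 ^ k] by rewrite -(eqn_modDl i) iE sE !modnMr.
rewrite !modn_small// => /eqP sr; split => //.
by apply/eqP; rewrite -(eqn_pmul2l N0) -sE -iE sr.
Qed.

Lemma precedes_congr k r a i j :
  precedes k r a i -> i = j %[mod 2 ^ k] -> 2 ^ k %| j + r.
Proof.
by move=> [_ _ iE] eq_ij; rewrite /dvdn -modnDml -eq_ij modnDml iE modnMr.
Qed.

Lemma precedes_dvd k r j : r < 2 ^ k -> 0 < j -> 2 ^ k %| j + r ->
  precedes k r ((j + r) %/ 2 ^ k) j.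
Proof.
move=> rN j0 /dvdnP[b jE]; rewrite jE mulnK ?expn_gt0//.
by split=> //; [case: b jE => //; lia|rewrite mulnC].
Qed.

(** * Words as windows of the sequence *)

Lemma pd_wordP m i j :
  pd_word m i = pd_word m j <->
  forall x, x < m -> pd_letter (i + x) = pd_letter (j + x).
Proof.
split=> [eq_ij x xm|eq_ij].
  have := congr1 (fun u => tnth u (Ordinal xm)) eq_ij.
  by rewrite !tnth_mktuple.
by apply: eq_from_tnth => x; rewrite !tnth_mktuple eq_ij.
Qed.

(** Renormalization: for windows in the same phase modulo 2^k only the letters
    at the multiples of 2^k can differ, and these form again windows of the
    sequence, up to a common complementation. *)
Lemma pd_word_renorm k m r a a' j j' :
    precedes k r a j -> precedes k r a' j' ->
  pd_word m j = pd_word m j' <->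
  forall y, r + 2 ^ k * y < m -> pd_letter (a + y) = pd_letter (a' + y).
Proof.
move=> [rN a0 jE] [_ a'0 j'E]; split=> [/pd_wordP eqW y ym|eqL].
  have := eqW _ ym; rewrite !addnA jE j'E -!mulnDr.
  by rewrite !pd_letter_pow2M ?addn_gt0 ?a0 ?a'0// => /addbI.
apply/pd_wordP => x xm.
have eq_mod : j + x = j' + x %[mod 2 ^ k].
  by apply/eqP; rewrite eqn_modDr -(eqn_modDr r) jE j'E !modnMr.
case: (boolP (2 ^ k %| j + x)) => [dvdx|]; last exact: pd_letter_congr.
have [y xE] : exists y, x = r + 2 ^ k * y.
  have rx : r = x %[mod 2 ^ k].
    apply/eqP; rewrite -(eqn_modDl j) jE modnMr eq_sym.
    exact: dvdx.
  exists (x %/ 2 ^ k); rewrite {1}(divn_eq x (2 ^ k)) -rx modn_small//; lia.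
move: xm; rewrite xE => xm; rewrite !addnA jE j'E -!mulnDr.
by rewrite !pd_letter_pow2M ?addn_gt0 ?a0 ?a'0// eqL.
Qed.

(** If one position is even and the other odd, the letters 0 at the odd places
    of the second window force the letters of the first one at two consecutive
    even places to be 0, so that the preimage under the substitution would
    contain the word 11. *)
Lemma pd_word_parity m i j : 2 < m -> 0 < i -> 0 < j ->
  pd_word m i = pd_word m j -> odd i = odd j.
Proof.
move=> m2; wlog: i j / ~~ odd i /\ odd j => [wl i0 j0 eq_ij|[oi oj] i0 _].
  case: (boolP (odd i)) => oi; case: (boolP (odd j)) => oj //.
    by have := wl j i (conj oj oi) j0 i0 (esym eq_ij); rewrite oi (negbTE oj).
  by have := wl i j (conj oi oj) i0 j0 eq_ij; rewrite oj (negbTE oi).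
move=> /pd_wordP eqL; exfalso.
have [b iE] : exists b, i = 2 * b by exists i./2; rewrite mul2n even_halfK.
have b0 : 0 < b by lia.
have e0 := eqL 0 (ltn_trans (ltn0Sn 1) m2); have e2 := eqL 2 m2.
have i2E : i + 2 = 2 * b.+1 by lia.
move: e0 e2; rewrite addn0 i2E iE !pd_letter_double//.
rewrite !(@pd_letter_odd (j + _)); [|by rewrite ?oddD ?oj..].
by move=> /negbFE /pd_letter_no11 ->.
Qed.

(** Induction along the substitution: the parity is known, and the letters at
    the even places form words of half the length. *)
Lemma pd_word_recognizable k m i j : 2 ^ k.+1 <= m -> 0 < i -> 0 < j ->
  pd_word m i = pd_word m j -> i = j %[mod 2 ^ k].
Proof.
elim: k m i j => [|k IH] m i j km i0 j0 eq_ij; first by rewrite !modn1.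
have m4 : 2 ^ 2 <= m by apply: leq_trans km; rewrite leq_exp2l.
have eq_odd := pd_word_parity (ltnW m4) i0 j0 eq_ij.
pose r : nat := odd i; pose a := uphalf i; pose b := uphalf j.
have iP : precedes 1 r a i by split; rewrite /r /a ?expn1; lia.
have jP : precedes 1 r b j by split; rewrite /r /b ?expn1; lia.
have [[r2 a0 iE] [_ b0 jE]] := (iP, jP).
have [/(_ eq_ij) eqL _] := pd_word_renorm m iP jP.
have eq_ab : a = b %[mod 2 ^ k].
  apply: (IH (2 ^ k.+1)) => //; apply/pd_wordP => y yk; apply: eqL.
  by move: km r2; rewrite expnS; lia.
apply/eqP; rewrite -(eqn_modDr r) iE jE expn1 expnS -!muln_modr.
by rewrite eq_ab.
Qed.

(** * Twin phases: equal words that are out of phase by half a period *)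

(** Only the letters at the multiples of H = 2^k matter.  One of the windows
    has its first such multiple at an even multiple of H; comparing with the
    odd multiples of the other window, where the letter is known, forces a
    letter 1 in both, and a third multiple inside the windows would force the
    forbidden word 11. *)
Lemma pd_word_eq_half k m i j : 2 ^ k.+1 <= m -> 0 < i -> 0 < j ->
    pd_word m i = pd_word m j -> i <> j %[mod 2 ^ k.+1] ->
  exists s a b, [/\ s < 2 ^ k, m <= 2 ^ k.+1 + s, pd_letter a, pd_letter b &
     (i + s = 2 ^ k.+1 * a /\ j + (s + 2 ^ k) = 2 ^ k.+1 * b) \/
     (j + s = 2 ^ k.+1 * a /\ i + (s + 2 ^ k) = 2 ^ k.+1 * b)].
Proof.
move=> km i0 j0 eqW neq.
have eqH := pd_word_recognizable km i0 j0 eqW.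
have H0 : 0 < 2 ^ k by rewrite expn_gt0.
have [s [b [sH b0 iE]]] := ceil_decomp H0 i0.
have [b' jE] : exists b', j + s = 2 ^ k * b'.
  have /dvdnP[b' ->] : 2 ^ k %| j + s.
    by rewrite /dvdn -modnDml -eqH modnDml iE modnMr.
  by exists b'; rewrite mulnC.
have b'0 : 0 < b' by case: b' jE => // ; rewrite muln0; lia.
have odd_neq : odd b != odd b'.
  apply/negP => /eqP odd_eq; apply: neq; apply/eqP.
  by rewrite -(eqn_modDr s) iE jE expnSr -!muln_modr !modn2 odd_eq.
wlog ev : i j b b' i0 j0 eqW b0 b'0 iE jE odd_neq {eqH neq} / ~~ odd b.
  move=> wl; case: (boolP (odd b)) => ob; last exact: (wl i j b b').
  have ob' : ~~ odd b' by move: odd_neq; rewrite ob; case: odd.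
  rewrite eq_sym in odd_neq.
  have [s' [a [c [? ? ? ? [|]]]]] :=
    wl j i b' b j0 i0 (esym eqW) b'0 b0 jE iE odd_neq ob'.
    by move=> ?; exists s', a, c; split=> //; right.
  by move=> ?; exists s', a, c; split=> //; left.
have ob' : odd b' by move: odd_neq; rewrite (negbTE ev); case: odd.
have [a bE] : exists a, b = 2 * a by exists b./2; lia.
have [c b'E] : exists c, b' = 2 * c + 1 by exists b'./2; lia.
have a0 : 0 < a by lia.
have iP : precedes k s b i by split.
have jP : precedes k s b' j by split.
have [/(_ eqW) eqL _] := pd_word_renorm m iP jP.
rewrite expnS in km *.
have La : pd_letter a.
  have /eqL : s + 2 ^ k * 0 < m by lia.
  by rewrite !addn0 (pd_letter_odd ob') bE pd_letter_double// => /negbFE.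
have Lc : pd_letter c.+1.
  have /eqL : s + 2 ^ k * 1 < m by lia.
  rewrite pd_letter_odd; last by rewrite bE; lia.
  have -> : b' + 1 = 2 * c.+1 by lia.
  by rewrite pd_letter_double// => /esym/negbFE.
exists s, a, c.+1; split => //; last first.
  by left; split; rewrite bE b'E in iE jE; lia.
rewrite leqNgt; apply/negP => sm.
have /eqL : s + 2 ^ k * 2 < m by lia.
have -> : b + 2 = 2 * a.+1 by lia.
rewrite pd_letter_double// (pd_letter_no11 La) pd_letter_odd//; lia.
Qed.

(** The multiples of H = 2^k in the two windows are among H (2a), H (2a+1) and
    H (2b-1), H (2b), and all four carry the same letter. *)
Lemma pd_word_half_eq k m i j s a b : s < 2 ^ k -> m <= 2 ^ k.+1 + s ->
    0 < a -> 0 < b -> pd_letter a -> pd_letter b ->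
    i + s = 2 ^ k.+1 * a -> j + (s + 2 ^ k) = 2 ^ k.+1 * b ->
  pd_word m i = pd_word m j.
Proof.
move=> sH ms a0 b0 La Lb iE jE; rewrite expnS in ms iE jE.
have iP : precedes k s (2 * a) i by split; lia.
have jP : precedes k s (2 * b).-1 j by split; lia.
apply/(pd_word_renorm m iP jP) => y ym.
have y2 : y < 2.
  have : 2 ^ k * y < 2 ^ k * 2 by lia.
  by rewrite ltn_pmul2l// expn_gt0.
have [->|y1] : y = 0 \/ y = 1 by lia.
  rewrite !addn0 pd_letter_double// La pd_letter_odd//; lia.
rewrite y1 [RHS](_ : _ = pd_letter (2 * b)); last by congr pd_letter; lia.
rewrite pd_letter_double// Lb pd_letter_odd//; lia.
Qed.

(** The hypothesis excludes the two shapes of [pd_word_eq_half], in which the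
    position i has the smaller, respectively the larger, residue. *)
Lemma pd_word_no_twin k m r a i j :
    2 ^ k <= m -> precedes k r a i ->
    (forall h, k = h.+1 -> pd_letter a ->
       (r < 2 ^ h -> 2 ^ k + r < m) /\ (2 ^ h <= r -> 2 ^ h + r < m)) ->
  0 < j -> pd_word m i = pd_word m j -> 2 ^ k %| j + r.
Proof.
move=> km iP notwin j0 eqW.
case: (eqVneq (i %% 2 ^ k) (j %% 2 ^ k)) => [|/eqP neq].
  exact: (precedes_congr iP).
exfalso; have i0 := precedes_gt0 iP.
case: k => [|h] in km iP notwin neq *; first by rewrite !modn1 in neq.
have [s [a' [b [sh ms La' Lb]]]] := pd_word_eq_half km i0 j0 eqW neq.
have HE := expnS 2 h.
move=> [] [E1 E2].
- have [|sr aE] := precedes_unique iP _ E1; first by lia.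
  by have [] := notwin h erefl; rewrite -?aE//; lia.
- have [|sr aE] := precedes_unique iP _ E2; first by lia.
  by have [] := notwin h erefl; rewrite -?aE//; lia.
Qed.

Lemma pd_letter_eq_short k m r a b :
    2 ^ k <= m -> r < 2 ^ k -> m <= 2 ^ k + r ->
  (forall y, r + 2 ^ k * y < m -> pd_letter (a + y) = pd_letter (b + y)) <->
  pd_letter a = pd_letter b.
Proof.
move=> km rN mr; split=> [/(_ 0)|eqL [|y] ym]; rewrite ?muln0 ?addn0//.
  by apply; lia.
by move: ym; rewrite mulnS; lia.
Qed.

Lemma pd_letter_eq_long k m r a b : m < 2 ^ k.+1 -> 2 ^ k + r < m ->
  (forall y, r + 2 ^ k * y < m -> pd_letter (a + y) = pd_letter (b + y)) <->
  pd_letter a = pd_letter b /\ pd_letter a.+1 = pd_letter b.+1.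
Proof.
move=> mk rm; split=> [eqL|[e0 e1] y ym].
  split; first by have := eqL 0; rewrite muln0 !addn0; apply; lia.
  by have := eqL 1; rewrite muln1 !addn1; apply; lia.
have y2 : y < 2.
  have : 2 ^ k * y < 2 ^ k * 2 by move: mk; rewrite expnS; lia.
  by rewrite ltn_pmul2l// expn_gt0.
by case: y y2 {ym} => [|[|//]] _; rewrite ?addn0 ?addn1.
Qed.

(** * Densities with bounded discrepancy *)

(** F has density c/(3N), with the bounded error e on every window of length
    N 2^n.  Windows of arbitrary length would only allow a logarithmic error. *)
Definition frequency e N c (F : nat -> nat) := forall n x, 0 < x ->
  c * 2 ^ n <= 3 * (\sum_(t < N * 2 ^ n) F (x + t)) + e /\
  3 * (\sum_(t < N * 2 ^ n) F (x + t)) <= c * 2 ^ n + e.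

Lemma frequency_eq e N c F G : (forall x, 0 < x -> F x = G x) ->
  frequency e N c F -> frequency e N c G.
Proof.
move=> FG fF n x x0; have := fF n x x0.
rewrite (eq_bigr (fun t : 'I__ => G (x + t)))// => t _.
by rewrite FG ?addn_gt0 ?x0.
Qed.

Lemma frequencyD e e' N c c' F G : frequency e N c F -> frequency e' N c' G ->
  frequency (e + e') N (c + c') (fun x => F x + G x).
Proof.
move=> fF fG n x x0; rewrite big_split/=; move: (fF n x x0) (fG n x x0).
move: (\sum_(t < _) F _) (\sum_(t < _) G _) => A B; lia.
Qed.

Lemma frequency_succ e N c F : frequency e N c F ->
  frequency e N c (fun x => F x.+1).
Proof. by move=> fF n x x0; exact: (fF n x.+1). Qed.

Lemma frequency_compl e c d F G : c + d = 3 ->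
    (forall x, 0 < x -> F x + G x = 1) ->
  frequency e 1 c F -> frequency e 1 d G.
Proof.
move=> cd FG fF n x x0; have := fF n x x0; rewrite mul1n.
have : \sum_(t < 2 ^ n) F (x + t) + \sum_(t < 2 ^ n) G (x + t) = 2 ^ n.
  rewrite -big_split/= -[RHS]card_ord -sum1_card.
  by apply: eq_bigr => t _; rewrite FG// addn_gt0 x0.
move: (\sum_(_ < _) _) (\sum_(_ < _) _) => A B AB.
have : d * 2 ^ n = 3 * 2 ^ n - c * 2 ^ n by rewrite -mulnBl -cd addKn.
lia.
Qed.

(** A window of length N M meets exactly M consecutive multiples of N. *)
Lemma sum_multiples N r x c M (g : nat -> nat) :
    r < N -> x + r = N * c ->
  \sum_(t < N * M) (if N %| x + t then g ((x + t) %/ N) else 0) =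
  \sum_(s < M) g (c + s).
Proof.
move=> rN xE; have N0 : 0 < N by lia.
elim: M => [|M IH]; first by rewrite muln0 !big_ord0.
rewrite big_ord_recr/= -IH mulnSr big_split_ord/=; congr addn.
rewrite (bigD1 (Ordinal rN))//= big1 ?addn0 => [|t tr].
  have -> : x + (N * M + r) = N * (c + M) by lia.
  by rewrite dvdn_mulr// mulKn.
case: ifPn => // dvdt; case/negP: tr; apply/eqP/val_inj => /=.
have : t = r %[mod N].
  apply/eqP; rewrite -(eqn_modDl (x + N * M)) -addnA (eqP dvdt).
  have -> : x + N * M + r = N * (c + M) by lia.
  by rewrite modnMr.
by rewrite !modn_small.
Qed.

Lemma frequency_dilate e N c r g : r < N -> frequency e 1 c g ->
  frequency e N c (fun x => if N %| x + r then g ((x + r) %/ N) else 0).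
Proof.
move=> rN fg n x x0; have N0 : 0 < N by lia.
have [r' [a [r'N a0 xE]]] :
    exists r' a, [/\ r' < N, 0 < a & x + r + r' = N * a].
  by apply: ceil_decomp => //; lia.
under eq_bigr do rewrite addnAC.
by rewrite (sum_multiples _ _ r'N xE); have := fg n a a0; rewrite mul1n.
Qed.

(** The number S_n of ones in a window of length 2^n satisfies
    S_(n+1) = 2^n - S_n for suitable windows, since the ones at even places are
    the zeros of a window of half the length.  Hence 3 S_n - 2^n only changes
    its sign, and it is -1 or 2 for n = 0. *)
Lemma frequency_pd_letter : frequency 2 1 1 (fun x => pd_letter x).
Proof.
move=> n; elim: n => [|n IH] x x0.
  by rewrite !mul1n big_ord1 addn0; case: (pd_letter x).
have [r [a [r2 a0 xE]]] := ceil_decomp (ltn0Sn 1) x0.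
have -> : \sum_(t < 1 * 2 ^ n.+1) pd_letter (x + t) =
    \sum_(s < 2 ^ n) ~~ pd_letter (a + s).
  rewrite mul1n expnS.
  rewrite -(sum_multiples (2 ^ n) (fun y => ~~ pd_letter y) r2 xE) /=.
  apply: eq_bigr => t _; rewrite dvdn2; case: ifPn => oxt; last first.
    by rewrite pd_letter_odd// -(negbK (odd _)).
  rewrite divn2 -{1}(even_halfK oxt) -mul2n pd_letter_double//; lia.
have : \sum_(s < 2 ^ n) pd_letter (a + s) +
    \sum_(s < 2 ^ n) ~~ pd_letter (a + s) = 2 ^ n.
  rewrite -big_split/= -[RHS]card_ord -sum1_card.
  by apply: eq_bigr => s _; case: pd_letter.
move: (IH a a0); rewrite !mul1n expnS.
by move: (\sum_(s < _) _) (\sum_(s < _) ~~ _) => A B; lia.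
Qed.

(** * Densities of words *)

(** If the word at i determines its residue r, then it occurs exactly at the
    positions with this residue for which g holds. *)
Lemma pd_word_frequency k m r a i c e (g : nat -> bool) :
    precedes k r a i ->
    frequency e 1 c g ->
    (forall j, 0 < j -> pd_word m i = pd_word m j -> 2 ^ k %| j + r) ->
    (forall b, (forall y, r + 2 ^ k * y < m ->
       pd_letter (a + y) = pd_letter (b + y)) <-> g b) ->
  frequency e (2 ^ k) c (fun j => pd_word m i == pd_word m j).
Proof.
move=> iP fg dvd gE; have [rN _ _] := iP.
apply: frequency_eq (frequency_dilate rN fg) => j j0.
case: ifPn => [dr|ndvd]; last first.
  by case: eqP => // /(dvd _ j0) dvdj; rewrite dvdj in ndvd.
have jP := precedes_dvd rN j0 dr.
congr nat_of_bool; apply/idP/eqP.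
  by move/(gE _)/(pd_word_renorm m iP jP).
by move/(pd_word_renorm m iP jP)/(gE _).
Qed.

(** The window meets two multiples of 2^k, so its density is that of a pair of
    letters. *)
Lemma frequency_long k m r a i :
    2 ^ k <= m < 2 ^ k.+1 -> precedes k r a i -> 2 ^ k + r < m ->
  exists e, frequency e (2 ^ k) 1 (fun j => pd_word m i == pd_word m j).
Proof.
move=> /andP[km mk] iP rm.
have dvd j : 0 < j -> pd_word m i = pd_word m j -> 2 ^ k %| j + r.
  apply: pd_word_no_twin km iP _ => h kE _.
  by move: rm; rewrite kE expnS; lia.
(* The pairs 10, 01, 00 are recognized by their only letter 1, or by having
   none. *)
case La : (pd_letter a).
  exists 2; apply: (pd_word_frequency iP frequency_pd_letter dvd) => b.
  rewrite pd_letter_eq_long// La (pd_letter_no11 La).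
  by split=> [[<-]//|Lb]; rewrite Lb (pd_letter_no11 Lb).
case La1 : (pd_letter a.+1).
  exists 2; apply: (pd_word_frequency iP
    (frequency_succ frequency_pd_letter) dvd) => b.
  rewrite pd_letter_eq_long// La La1.
  split=> [[_ <-]//|Lb1]; rewrite Lb1.
  by split=> //; apply/esym/negP => /pd_letter_no11; rewrite Lb1.
exists (2 + 2).
apply: (pd_word_frequency (g := fun b => ~~ (pd_letter b || pd_letter b.+1))
  iP _ dvd).
  apply: frequency_compl (frequencyD frequency_pd_letter
    (frequency_succ frequency_pd_letter)) => // x _.
  by case Lx : (pd_letter x);
    [rewrite (pd_letter_no11 Lx)|case: (pd_letter x.+1)].
move=> b; rewrite pd_letter_eq_long// La La1.
by case: (pd_letter b); case: (pd_letter b.+1) => //=; split => // -[].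
Qed.

(** The window meets one multiple of 2^k, so its density is that of a letter;
    the last hypothesis excludes a twin. *)
Lemma frequency_short k m r a i :
    2 ^ k <= m -> precedes k r a i -> m <= 2 ^ k + r ->
    (forall h, k = h.+1 -> pd_letter a -> 2 ^ h <= r /\ 2 ^ h + r < m) ->
  exists e, frequency e (2 ^ k) (if pd_letter a then 1 else 2)
    (fun j => pd_word m i == pd_word m j).
Proof.
move=> km iP mr notwin; have [rN _ _] := iP.
have dvd j : 0 < j -> pd_word m i = pd_word m j -> 2 ^ k %| j + r.
  by apply: pd_word_no_twin km iP _ => h kE La; have := notwin h kE La; lia.
case La : (pd_letter a); exists 2.
  apply: (pd_word_frequency iP frequency_pd_letter dvd) => b.
  by rewrite pd_letter_eq_short// La; split=> [<-|->].
apply: (pd_word_frequency (g := fun b => ~~ pd_letter b) iP _ dvd).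
  by apply: frequency_compl frequency_pd_letter => // x _; case: pd_letter.
move=> b; rewrite pd_letter_eq_short// La.
by case: pd_letter; split.
Qed.

(** The word occurs in two phases, with residues r and r - 2^h, in each of them
    once for every letter 1. *)
Lemma frequency_twin h m r a i : 2 ^ h.+1 <= m -> precedes h.+1 r a i ->
    pd_letter a -> 2 ^ h <= r -> m <= 2 ^ h + r ->
  exists e, frequency e (2 ^ h.+1) 2 (fun j => pd_word m i == pd_word m j).
Proof.
move=> hm iP La hr mr; have [rN a0 iE] := iP.
have HE := expnS 2 h.
have i0 := precedes_gt0 iP.
have H0 : 0 < 2 ^ h by rewrite expn_gt0.
pose s := r - 2 ^ h; have sN : s < 2 ^ h.+1 by rewrite /s; lia.
exists (2 + 2); apply: frequency_eq (frequencyD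
  (frequency_dilate rN frequency_pd_letter)
  (frequency_dilate sN frequency_pd_letter)) => j j0.
have Ndvd : 2 ^ h.+1 %| j + r -> 2 ^ h.+1 %| j + s -> False.
  move=> dr /(dvdn_sub dr).
  rewrite (_ : _ - _ = 2 ^ h); last by rewrite /s; lia.
  by move/dvdn_leq => /(_ H0); lia.
have mr' : m <= 2 ^ h.+1 + r by lia.
have [dr|ndr] := boolP (2 ^ h.+1 %| j + r).
  case: ifPn => [/(Ndvd dr)//|_]; rewrite addn0.
  have jP := precedes_dvd rN j0 dr.
  congr nat_of_bool; apply/idP/eqP => [Lb|/(pd_word_renorm m iP jP)].
    by apply/(pd_word_renorm m iP jP)/pd_letter_eq_short => //; rewrite La Lb.
  by move/pd_letter_eq_short => <-.
rewrite add0n; have [ds|nds] := boolP (2 ^ h.+1 %| j + s).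
  have [_ b0 jE] := precedes_dvd sN j0 ds.
  congr nat_of_bool; apply/idP/eqP => [Lb|eqW].
    apply/esym; apply: (pd_word_half_eq _ _ b0 a0 Lb La jE) => //;
    rewrite /s; lia.
  have neq : i <> j %[mod 2 ^ h.+1].
    by move=> /(precedes_congr iP) dr; rewrite dr in ndr.
  have [s' [a' [b [sh ms La' Lb]]]] := pd_word_eq_half hm i0 j0 eqW neq.
  case=> -[E1 E2].
    by have [] := precedes_unique iP _ E1; lia.
  have [|s'E _] := precedes_unique iP _ E2; first by lia.
  have [] := precedes_unique (precedes_dvd sN j0 ds) _ E1; first by lia.
  by move=> _ <-.
case: eqP => // eqW; case/negP: nds.
have neq : i <> j %[mod 2 ^ h.+1].
  by move=> /(precedes_congr iP) dr; rewrite dr in ndr.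
have [s' [a' [b [sh ms La' Lb]]]] := pd_word_eq_half hm i0 j0 eqW neq.
case=> -[E1 E2].
  by have [] := precedes_unique iP _ E1; lia.
have [|s'E _] := precedes_unique iP _ E2; first by lia.
by rewrite (_ : s = s') ?E1 ?dvdn_mulr// /s; lia.
Qed.

(** * From densities to measures *)

(** The t-th preimage of the cylinder under the shift; in this form it is
    visibly an open set that depends on finitely many letters. *)
Definition window t m (u : m.-tuple bool) : set cantor_space :=
  [set a | forall j : 'I_m, a (t + j)%N = tnth u j].

Lemma open_window t m (u : m.-tuple bool) : open (window t u).
Proof.
rewrite openE => a au; rewrite /interior /=.
change (\forall b \near a, forall j : 'I_m, b (t + j)%N = tnth u j).
apply: (@filter_forall cantor_space 'I_m
  (fun j b => b (t + j)%N = tnth u j) (nbhs a) (nbhs_filter a)) => j.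
rewrite -au.
apply: (@proj_continuous _ (fun=> bool) (t + j)%N a [set a (t + j)%N]).
exact: discrete_set1.
Qed.

(** Points of the subshift are limits of shifts of omega, and long initial words
    are open conditions. *)
Lemma pd_space_window (a : cantor_space) L : pd_space a ->
  exists2 i, (0 < i)%N & forall n, (n < L)%N -> a n = pd_letter (i + n).
Proof.
pose u := [tuple a j | j < L].
have au : window 0 u a by move=> j; rewrite tnth_mktuple.
move=> /(_ (window 0 u)) [|_ [[n _ <-] win]].
  by apply: open_nbhs_nbhs; split => //; exact: open_window.
have iterE x : iter n Defs.shift pd_seq x = pd_letter (n.+1 + x).
  elim: n {win} x => // n IH x.
  by rewrite [LHS]IH addnS.
exists n.+1 => // x xL; have := win (Ordinal xL).
by rewrite tnth_mktuple iterE.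
Qed.

Local Open Scope ring_scope.

Lemma measurable_window t m (u : m.-tuple bool) :
  measurable (set_val @^-1` window t u : set (borel pd_subshift)).
Proof.
by apply: sub_sigma_algebra; exists (window t u) => //; exact: open_window.
Qed.

Lemma measure_window (R : realType)
    (mu : probability (borel pd_subshift) R) t m (u : m.-tuple bool) :
    pd_invariant mu ->
  mu (set_val @^-1` window t u : set (borel pd_subshift)) =
  mu (set_val @^-1` cylinder u : set (borel pd_subshift)).
Proof.
move=> mu_inv; elim: t => // t <-; rewrite -(mu_inv _ (measurable_window t u)).
by congr (mu _); apply/seteqP; split.
Qed.

(** The number of visits to the cylinder during L steps has integral L times
    the measure by invariance, and its value at a point of the subshift is a
    number of occurrences of u in a window of omega. *)
Lemma measure_cylinder_average (R : realType)
    (mu : probability (borel pd_subshift) R) m (u : m.-tuple bool) L lo hi :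
    pd_invariant mu ->
    (forall i, (0 < i)%N ->
       lo <= \sum_(t < L) (u == pd_word m (i + t)) <= hi)%N ->
  lo%:R <= L%:R * fine (mu (set_val @^-1` cylinder u)) <= hi%:R.
Proof.
move=> mu_inv bnd.
pose A t : set (borel pd_subshift) := set_val @^-1` window t u.
have mA t : measurable (A t) by exact: measurable_window.
pose f x : \bar R := (\sum_(t < L) (\1_(A t) x)%:E)%E.
have fE x : exists2 i, (0 < i)%N &
    f x = (\sum_(t < L) (u == pd_word m (i + t)))%N%:R%:E.
  have [i i0 xE] := @pd_space_window (set_val x) (L + m) (set_valP x).
  exists i => //; rewrite /f sumEFin natr_sum; congr (_%:E).
  apply: eq_bigr => t _; rewrite indicE; congr (_%:R); congr nat_of_bool.
  apply/idP/eqP => [/set_mem xA|uE]; last (apply/mem_set => j).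
    apply: eq_from_tnth => j; rewrite -(xA j) tnth_mktuple xE ?addnA//.
    by rewrite -addSn leq_add// ltnW.
  rewrite uE tnth_mktuple /= xE ?addnA//.
  by rewrite -addSn leq_add// ltnW.
have mf1 t : measurable_fun setT (EFin \o (\1_(A t) : borel pd_subshift -> R)).
  by apply/measurable_EFinP; exact: measurable_indic.
have mf : measurable_fun setT f.
  by apply: (emeasurable_sum _ (h := fun (t : 'I_L) x => (\1_(A t) x)%:E)) => t;
  exact: mf1.
have f0 t (x : borel pd_subshift) : (0 <= (\1_(A t) x)%:E :> \bar R)%E.
  by rewrite lee_fin indicE.
have f_ge0 x : (0 <= f x)%E by apply: sume_ge0 => t _; exact: f0.
have muE : mu (set_val @^-1` cylinder u) =
    (fine (mu (set_val @^-1` cylinder u)))%:E.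
  by rewrite fineK// fin_num_measure//; exact: (measurable_window 0).
have intf : (\int[mu]_x f x =
    (L%:R * fine (mu (set_val @^-1` cylinder u)))%:E)%E.
  rewrite (ge0_integral_sum _ measurableT
    (f := fun (t : 'I_L) x => (\1_(A t) x)%:E) (fun t => mf1 t))//.
  rewrite (eq_bigr (fun=> mu (set_val @^-1` cylinder u))) => [|t _].
    by rewrite muE sumEFin sumr_const card_ord mulr_natl.
  by rewrite integral_indic// setIT; exact: measure_window.
have int_cst r : (\int[mu]_x (r%:R%:E : \bar R) = r%:R%:E)%E.
  rewrite integral_cst// -[RHS]mule1; congr (_ * _)%E; exact: probability_setT.
apply/andP; split; rewrite -lee_fin -intf -int_cst;
  apply: ge0_le_integral => //;
  by move=> x _; have [i i0 ->] := fE x; rewrite lee_fin ler_nat;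
  case/andP: (bnd i i0).
Qed.

Lemma eq0_pow2_bounded (R : realType) (x B : R) :
  (forall n, 2 ^+ n * `|x| <= B) -> x = 0.
Proof.
move=> xB; apply: contrapT => /eqP; rewrite -normr_gt0 => x0.
pose n := Num.bound (B / `|x|).
have B0 : 0 <= B by apply: le_trans (xB 0%N); rewrite mulr_ge0// exprn_ge0.
have := archi_boundP (divr_ge0 B0 (ltW x0)); rewrite ltr_pdivrMr// -/n.
apply/negP; rewrite -leNgt; apply: le_trans (xB n).
by rewrite ler_wpM2r// -natrX ler_nat ltnW// ltn_expl.
Qed.

(** By [measure_cylinder_average] on windows of length 2^k 2^n, the difference
    3 2^k p - c for the measure p of the cylinder is at most (e + 3) / 2^n for
    every n. *)
Lemma measure_cylinder_frequency (R : realType)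
    (mu : probability (borel pd_subshift) R) e k c m (u : m.-tuple bool) :
    pd_invariant mu ->
    frequency e (2 ^ k) c (fun i => u == pd_word m i) ->
  mu (set_val @^-1` cylinder u) = (c%:R / (3 * 2 ^+ k))%:E.
Proof.
move=> mu_inv freq.
have muE : mu (set_val @^-1` cylinder u) =
    (fine (mu (set_val @^-1` cylinder u)))%:E.
  by rewrite fineK// fin_num_measure//; exact: (measurable_window 0).
rewrite muE; congr (_%:E); set p := fine _.
suff : 3 * 2 ^+ k * p - c%:R = 0.
  move=> /eqP; rewrite subr_eq0 => /eqP <-.
  by rewrite mulrC mulKf// mulf_neq0// ?pnatr_eq0// expf_neq0// pnatr_eq0.
apply: (@eq0_pow2_bounded _ _ (e%:R + 3)) => n.
rewrite -[2 ^+ n]ger0_norm ?exprn_ge0// -normrM.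
(* Rounding to integers enlarges the error by at most 3. *)
pose lo := ((c * 2 ^ n - e) %/ 3)%N; pose hi := ((c * 2 ^ n + e) %/ 3)%N.
have /andP[] := @measure_cylinder_average _ mu _ u (2 ^ k * 2 ^ n) lo hi mu_inv
  (fun i i0 => ltac:(have := freq n i i0; rewrite /lo /hi; lia)).
have hiB : (3 * hi <= c * 2 ^ n + e)%N by rewrite /hi; lia.
have loB : (c * 2 ^ n <= 3 * lo + e + 3)%N by rewrite /lo; lia.
move: hiB loB; rewrite -!(ler_nat R) !natrD !natrM !natrX -/p.
move: (lo%:R) (hi%:R) (c%:R) (e%:R) (2%:R ^+ k) (2%:R ^+ n) => l h C E K M.
move=> hB lB lp hp; rewrite ler_norml; apply/andP; split; nra.
Qed.

(** * The least position of a word *)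

(** For k = 0 the second alternative of the theorem is void: then q = 0, and no
    integer i satisfies 1 < i <= 3/2. *)
Lemma late_alternativeE (R : realType) k m i : (2 ^ k <= m < 2 ^ k.+1)%N ->
  [/\ (m - 2 ^ k)%:R < 2 ^ (k%:Z - 1) :> R, (2 ^ k < i)%N
    & i%:R <= 2 ^+ k + 2 ^ (k%:Z - 1) - (m - 2 ^ k)%:R :> R] <->
  exists h, [/\ k = h.+1, (2 ^ k < i)%N & (i + (m - 2 ^ k) <= 2 ^ k + 2 ^ h)%N].
Proof.
case: k => [|h] /andP[km mk].
  split=> [[_ i1 ile]|[h []//]].
  have i2 : 2 <= i%:R :> R by rewrite ler_nat.
  have half : 2 ^ (0%N%:Z - 1) = 2^-1 :> R by [].
  have q0 : (m - 2 ^ 0 = 0)%N by lia.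
  move: (i%:R) i2 ile => x i2; rewrite expr0 half q0 subr0 => ile.
  by clear - i2 ile; lra.
have -> : 2 ^ (h.+1%:Z - 1) = (2 ^ h)%:R :> R.
  by rewrite (_ : h.+1%:Z - 1 = h%:Z) ?natrX//; lia.
rewrite ltr_nat lerBrDr -natrX -!natrD ler_nat.
split=> [[_ ? ?]|[_ [[<-] ? ?]]]; first by exists h.
split=> //; lia.
Qed.

Theorem theorem1p2 (R : realType) (mu : probability (borel pd_subshift) R)
    (mu_invariant : pd_invariant mu)
    (m : nat) (m_ge1 : (1 <= m)%N) (u : m.-tuple bool) (u_allowed : allowed u)
    (k : nat) (k_bounds : (2 ^ k <= m < 2 ^ k.+1)%N)
    (q : nat) (qE : q = (m - 2 ^ k)%N)
    (i : nat) (i_ge1 : (1 <= i)%N) (i_word : u = pd_word m i)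
    (i_least : forall j : nat, (1 <= j)%N -> u = pd_word m j -> (i <= j)%N) :
  let mu_u := mu (set_val @^-1` cylinder u : set (borel pd_subshift)) in
  let case1 :=
    (i <= 2 ^ k - q)%N \/
    [/\ q%:R < 2 ^ (k%:Z - 1) :> R, (2 ^ k < i)%N
      & i%:R <= 2 ^+ k + 2 ^ (k%:Z - 1) - q%:R :> R] in
  [/\ (1 <= i <= 3 * 2 ^ k)%N,
      case1 -> mu_u = (2 / (3 * 2 ^+ k))%:E
    & ~ case1 -> mu_u = (1 / (3 * 2 ^+ k))%:E].
Proof.
move=> mu_u case1.
have [km mk] := andP k_bounds; have mk2 := mk; rewrite expnS in mk2.
have N0 : (0 < 2 ^ k)%N by rewrite expn_gt0.
have case1P : case1 <-> (i <= 2 ^ k - q)%N \/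
    exists h, [/\ k = h.+1, (2 ^ k < i)%N & (i + q <= 2 ^ k + 2 ^ h)%N].
  by rewrite /case1 qE; split=> -[?|/(late_alternativeE R i k_bounds) ?];
  [left|right|left|right].
have [r [a iP]] : exists r a, precedes k r a i.
  by have [r [a ?]] := ceil_decomp N0 i_ge1; exists r, a.
have [rN a0 iE] := iP.
have measureE c : (exists e,
    frequency e (2 ^ k) c (fun j => pd_word m i == pd_word m j)) ->
  mu_u = (c%:R / (3 * 2 ^+ k))%:E.
  by case=> e fc; rewrite /mu_u i_word; exact: measure_cylinder_frequency fc.
have least b : (0 < b)%N -> (forall y, (r + 2 ^ k * y < m)%N ->
    pd_letter (a + y) = pd_letter (b + y)) -> (a <= b)%N.
  move=> b0 eqL; have Nb : (2 ^ k * 1 <= 2 ^ k * b)%N by rewrite leq_pmul2l.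
  have jP : precedes k r b (2 ^ k * b - r) by split=> //; lia.
  have /(pd_word_renorm m iP jP) eqW := eqL.
  have := i_least _ (precedes_gt0 jP); rewrite i_word => /(_ eqW) ij.
  by rewrite -(leq_pmul2l N0); lia.
have a3 : (a <= 3)%N.
  have [b [b0 b3 Lb Lb1]] := pd_letter_pair_early a.
  apply: leq_trans b3; apply: least => // -[|[|y]] ym; rewrite ?addn0 ?addn1//.
  by move: ym; rewrite !mulnS; lia.
have Na3 : (2 ^ k * a <= 2 ^ k * 3)%N by rewrite leq_pmul2l.
have Na1 : (2 ^ k * 1 <= 2 ^ k * a)%N by rewrite leq_pmul2l.
have small : (1 <= i <= 3 * 2 ^ k)%N by lia.
suff [[c1 mu2]|[nc1 mu1]] :
    (case1 /\ mu_u = (2 / (3 * 2 ^+ k))%:E) \/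
    (~ case1 /\ mu_u = (1 / (3 * 2 ^+ k))%:E) by split.
have [rm|mr] := ltnP (2 ^ k + r) m.
  right; split; last exact: (measureE 1 (frequency_long k_bounds iP rm)).
  rewrite case1P => -[|[h [kE Ni ile]]]; first by lia.
  have NH : (2 ^ k = 2 * 2 ^ h)%N by rewrite kE expnS.
  have : (2 ^ k * 2 <= 2 ^ k * a)%N.
    by rewrite leq_pmul2l// ltnNge; apply/negP => a1;
      have : (2 ^ k * a <= 2 ^ k * 1)%N; [rewrite leq_pmul2l|lia].
  lia.
case La : (pd_letter a); last first.
  have aE : a = 1%N.
    apply/eqP; rewrite eqn_leq a0 andbT; apply: least => //.
    by apply/(pd_letter_eq_short _ _ km rN mr).
  left; split; first by rewrite case1P; left; rewrite aE in iE; lia.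
  apply: measureE; have := frequency_short km iP mr.
  by rewrite La; apply=> h _.
have aE : a = 2%N.
  apply/eqP; rewrite eqn_leq least//=.
    by case: a La a0 {iP iE least a3 Na3 Na1} => [|[|]].
  by apply/(pd_letter_eq_short _ _ km rN mr).
rewrite aE in iE.
(* With a twin, minimality of i selects the phase with the larger residue. *)
have half_le h : k = h.+1 -> (2 ^ h <= r)%N.
  move=> kE; have NH : (2 ^ k = 2 * 2 ^ h)%N by rewrite kE expnS.
  rewrite leqNgt; apply/negP => rh.
  have jE : ((2 ^ k * 2 - (r + 2 ^ h)) + (r + 2 ^ h) = 2 ^ k * 2)%N by lia.
  have eqW : pd_word m i = pd_word m (2 ^ k * 2 - (r + 2 ^ h)).
    by apply: (@pd_word_half_eq h m _ _ r 2 2); rewrite -?kE.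
  have H0 : (0 < 2 ^ h)%N by rewrite expn_gt0.
  have j0 : (0 < 2 ^ k * 2 - (r + 2 ^ h))%N by lia.
  by have := i_least _ j0; rewrite i_word => /(_ eqW); lia.
have [[h [kE mh]]|notwin] :=
    pselect (exists h, k = h.+1 /\ (m <= 2 ^ h + r)%N).
  left; split.
    by rewrite case1P; right; exists h; split => //; lia.
  apply: measureE; have hr := half_le h kE.
  rewrite kE in km iP *; exact: (frequency_twin km iP La hr mh).
right; split.
  rewrite case1P => -[|[h [kE Ni ile]]]; first by lia.
  by apply: notwin; exists h; split => //; lia.
apply: (measureE 1).
have := frequency_short km iP mr; rewrite La; apply=> h kE _.
split; first exact: half_le.
by rewrite ltnNge; apply/negP => mh; apply: notwin; exists h.
Qed.
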